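(* Let $E$ be a real Banach space, let $I_0, I$ be finite index sets with $I_0\cup I=\{1,\dots,n\}$ (either one may be empty), let $h_i:E\to\mathbb{R}$, $i\in I_0\cup I$, and let $$\mathcal F:=\{x\in E \mid h_i(x)=0,\ i\in I_0,\ h_i(x)\le 0,\ i\in I\}.$$ Let $x_0\in\mathcal F$, and suppose that all $h_i$, $i\in I_0\cup I$, are of class $C^1$ in a neighbourhood of $x_0$. Assume that the relaxed constant rank constraint qualification (RCRCQ) holds for $\mathcal F$ at $x_0$. Then the Abadie condition holds, i.e. $\Gamma_{\mathcal F}(x_0)=T_{\mathcal F}(x_0)$. Moreover, for each $d\in T_{\mathcal F}(x_0)$ there is a function $r:(0,1)\to E$ with $\|r(t)\|/t\to 0$ as $t\downarrow 0$, such that for all sufficiently small $t>0$ $$h_i(x_0+td+r(t))=0,\quad i\in J(d),\qquad h_\ell(x_0+td+r(t))\le 0,\quad \ell\in I\setminus J(d),$$ where $J(d):=I_0\cup I(x_0,d)$. Additionally, whenever $J(d)\neq\emptyset$, one has $$\operatorname{rank}\{Dh_i(x_0+td+r(t)),\ i\in J(d)\}=\operatorname{rank}\{Dh_i(x_0),\ i\in J(d)\}=:k$$ for all sufficiently small $t>0$, and $d\in\ker Dh(x_0)$, where $h:=[h_{i_1},\dots,h_{i_k}]$ and $i_1,\dots,i_k\in J(d)$ are indices such that $Dh_{i_1}(x_0),\dots,Dh_{i_k}(x_0)$ are linearly independent.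
   Context: $Dh_i(x)\in E^*$ is the Fréchet derivative and $\langle\cdot,\cdot\rangle$ is the duality pairing between $E^*$ and $E$. The rank of a finite family of vectors is the cardinality of a maximal linearly independent subfamily. Active index set: $I(x_0):=\{i\in I\mid h_i(x_0)=0\}$. For $d\in E$: $I(x_0,d):=\{i\in I(x_0)\mid \langle Dh_i(x_0),d\rangle=0\}$. Linearized cone: $\Gamma_{\mathcal F}(x_0):=\{d\in E\mid \langle Dh_i(x_0),d\rangle\le 0,\ i\in I(x_0),\ \langle Dh_i(x_0),d\rangle=0,\ i\in I_0\}$. Tangent cone: for $C\subset E$ and $x_0\in\operatorname{cl} C$, $T_C(x_0)$ is the set of all $d\in E$ for which there exist $\varepsilon>0$ and a vector function $o(t)\in E$ with $\|o(t)\|t^{-1}\to 0$ as $t\downarrow 0$ and $x_0+td+o(t)\in C$ for all $0\le t\le\varepsilon$. RCRCQ holds for $\mathcal F$ at $x_0\in\mathcal F$ if there is a neighbourhood $U(x_0)$ such that for every index set $J$ with $I_0\subset J\subset I_0\cup I(x_0)$, $\operatorname{rank}\{Dh_i(x),\ i\in J\}=\operatorname{rank}\{Dh_i(x_0),\ i\in J\}$ for all $x\in U(x_0)$. *)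

(* Defs.v *)
From HB Require Import structures.
From mathcomp Require Import all_boot all_order all_algebra.
From mathcomp Require Import all_classical all_reals all_analysis.

Set Implicit Arguments.
Unset Strict Implicit.
Unset Printing Implicit Defensive.

Import Order.TTheory GRing.Theory Num.Theory.
Import numFieldNormedType.Exports.

Local Open Scope classical_set_scope.
Local Open Scope ring_scope.

Section Rank.
Context {R : realType} {V : lmodType R} {K : finType}.

(* Linear independence of the subfamily of [v] indexed by [S], as a family:
   a vector repeated at two indices of [S] makes it dependent. *)
Definition lin_indep (v : K -> V) (S : {set K}) : Prop :=
  forall c : K -> R, \sum_(k in S) c k *: v k = 0 -> forall k, k \in S -> c k = 0.

Definition family_rank (v : K -> V) (S : {set K}) : nat :=
  (\max_(T : {set K} | (T \subset S) && `[< lin_indep v T >]) #|T|)%N.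

End Rank.

Section C1.
Context {R : realType} {E : normedModType R}.

(* Only meaningful when [phi] is bounded on the unit ball; below it is applied
   to differences of Frechet derivatives at points of differentiability. *)
Definition dual_norm (phi : E -> R) : R :=
  sup [set `|phi v| | v in [set v : E | `|v| <= 1]].

Definition C1_near (f : E -> R) (x0 : E) : Prop :=
  \forall x \near x0, differentiable f x /\
    dual_norm (fun v => 'd f y v - 'd f x v) @[y --> x] --> (0 : R).

Definition tangent_cone (C : set E) (x0 : E) : set E :=
  [set d | exists eps : R, exists o : R -> E,
    [/\ 0 < eps,
        `|o t| * t^-1 @[t --> 0^'+] --> (0 : R) &
        forall t, 0 <= t <= eps -> C (x0 + t *: d + o t)]].

End C1.

(* The constraints are indexed by 'I_n in place of {1, ..., n}; [I0] indexes the
   equalities and [I] the inequalities.  The two sets need not be disjoint. *)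
Section Constraints.
Context {R : realType} {E : normedModType R} {n : nat}.
Variables (I0 I : {set 'I_n}) (h : 'I_n -> E -> R).

Definition feasible : set E :=
  [set x | (forall i, i \in I0 -> h i x = 0) /\
           (forall i, i \in I -> h i x <= 0)].

Definition active (x0 : E) : {set 'I_n} :=
  finset (fun i => (i \in I) && (h i x0 == 0)).

Definition active_dir (x0 d : E) : {set 'I_n} :=
  finset (fun i => (i \in active x0) && ('d (h i) x0 d == 0)).

Definition Jdir (x0 d : E) : {set 'I_n} := I0 :|: active_dir x0 d.

Definition linearized_cone (x0 : E) : set E :=
  [set d | (forall i, i \in active x0 -> 'd (h i) x0 d <= 0) /\
           (forall i, i \in I0 -> 'd (h i) x0 d = 0)].

(* The rank is computed in the space of all functions E -> R, of which E^* is a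
   linear subspace. *)
Definition Dh_rank (J : {set 'I_n}) (x : E) : nat :=
  family_rank (fun i => 'd (h i) x : E -> R^o) J.

Definition RCRCQ (x0 : E) : Prop :=
  exists U : set E, nbhs x0 U /\
    forall J : {set 'I_n}, I0 \subset J -> J \subset I0 :|: active x0 ->
      forall x, U x -> Dh_rank J x = Dh_rank J x0.

End Constraints.

(* Main.v *)
(* Let d be a linearized direction and choose a maximal independent subfamily
   Dh_j(x0), j in S, of the gradients indexed by J(d), with dual vectors e_j.
   For each small t, a fixed point r(t) of the contraction
     p |-> sum_(j in S) (Dh_j(x0)(t d + p) - h_j(x0 + t d + p)) e_j
   annihilates h_j, j in S, at z(t) = x0 + t d + r(t).  The map on the right has
   strict derivative 0 at x0, so r is Lipschitz and r(t) = o(t).  By constant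
   rank, near x0 every Dh_i, i in J(d), is a combination of the Dh_j, j in S;
   subtracting from h_i the same combination of the h_j, which vanish along z,
   leaves a function with zero differential at z(t).  Hence h_i(z(t)) has zero
   derivative in t: a Lipschitz curve z is enough, and the implicit function
   theorem is not needed. *)

Require Import Defs.
From HB Require Import structures.
From mathcomp Require Import all_boot all_order all_algebra.
From mathcomp Require Import all_classical all_reals all_analysis.
From mathcomp Require Import ring lra.

Set Implicit Arguments.
Unset Strict Implicit.
Unset Printing Implicit Defensive.

Import Order.TTheory GRing.Theory Num.Theory.
Import numFieldNormedType.Exports.

Local Open Scope classical_set_scope.
Local Open Scope ring_scope.

(* [f] has strict derivative 0 at [x]. *)
Definition strictly_flat {R : realType} {V W : normedModType R}
    (f : V -> W) (x : V) : Prop :=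
  forall e : R, 0 < e -> \forall r \near 0^'+, forall z z',
    ball x r z -> ball x r z' -> `|f z - f z'| <= e * `|z - z'|.

(** * Differentials of $C^1$ functions near a point *)

Section Calculus.
Context {R : realType} {E : normedModType R}.
Implicit Types (f : E -> R) (x d v z : E).

Lemma diff_norm_bound f x : differentiable f x ->
  exists2 M : R, 0 < M & forall v, `|'d f x v| <= M * `|v|.
Proof.
move=> dfx; have /linear_bounded_continuous/linear_boundedP := diff_continuous dfx.
by move=> /pinfty_ex_gt0[M M0 bM]; exists M.
Qed.

(** The bound [M] makes the set behind [dual_norm] bounded, so that [sup] is a genuine supremum; the
    estimate then follows by scaling [v] to norm 1. *)
Lemma le_dual_norm (phi : {linear E -> R}) (M : R) :
  (forall v, `|phi v| <= M * `|v|) ->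
  forall v, `|phi v| <= dual_norm phi * `|v|.
Proof.
move=> phiM v; have [->|v0] := eqVneq v 0; first by rewrite linear0 !normr0 mulr0.
have nv0 : 0 < `|v| by rewrite normr_gt0.
rewrite -ler_pdivrMr//; apply: ub_le_sup.
  exists `|M| => _ [w /= w1 <-]; rewrite (le_trans (phiM w))//.
  by rewrite (le_trans (ler_norm _))// normrM normr_id ler_piMr.
exists (`|v|^-1 *: v) => /=; last by rewrite linearZ normrM gtr0_norm ?invr_gt0// mulrC.
by rewrite normrZ gtr0_norm ?invr_gt0// mulVf// gt_eqF.
Qed.

Lemma C1_near_differentiable f x : C1_near f x -> differentiable f x.
Proof. by move=> /nbhs_singleton[]. Qed.

(** Continuity of the derivative is used at [x] itself; differentiability at nearby [y] bounds both
    differentials, which [le_dual_norm] needs for their difference. *)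
Lemma C1_near_diff_le f x (e : R) : C1_near f x -> 0 < e ->
  \forall y \near x, differentiable f y /\
    forall v, `|'d f y v - 'd f x v| <= e * `|v|.
Proof.
move=> C1f e0; have [dfx /cvgr0_norm_le/(_ _ e0) nde] := nbhs_singleton C1f.
near=> y; have [dfy _] : differentiable f y /\
    dual_norm (fun v => 'd f z v - 'd f y v) @[z --> y] --> (0 : R).
  by near: y; exact: C1f.
have dle : `|dual_norm (fun v => 'd f y v - 'd f x v)| <= e by near: y.
split=> // v.
have [[M M0 bM] [N N0 bN]] := (diff_norm_bound dfx, diff_norm_bound dfy).
pose phi : {linear E -> R} := ('d f y \- 'd f x)%R.
have := @le_dual_norm phi (N + M) _ v; move=> /(_ _)/le_trans; apply.
  by move=> w; rewrite (le_trans (ler_normB _ _))// mulrDl lerD.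
by rewrite ler_wpM2r// (le_trans (ler_norm _)).
Unshelve. all: by end_near. Qed.

Lemma is_derive_segment f x v (s : R) : differentiable f (x + s *: v) ->
  is_derive s 1 (fun s => f (x + s *: v)) ('d f (x + s *: v) v).
Proof.
move=> df.
have [dl dlE] : is_diff s (fun s : R => x + s *: v) (fun s : R => s *: v).
  have -> : (fun s : R => s *: v) = 0 + (fun s : R => s *: v) by rewrite add0r.
  exact: is_diffD.
have dc : differentiable (f \o (fun s : R => x + s *: v)) s.
  exact: differentiable_comp.
apply: DeriveDef; first exact/derivable1_diffP.
by rewrite deriveE// diff_comp//= dlE scale1r.
Qed.

(** Mean value theorem on the segment from [z'] to [z], which stays in a small ball where the
    differential of [f] is within [e] of that at [x]. *)
Lemma C1_near_strictly_flat f x : C1_near f x ->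
  strictly_flat (fun z => f z - 'd f x z) x.
Proof.
move=> C1f e e0; have [r0 /= r00 dfe] := (nbhs_ballP _ _).1 (C1_near_diff_le C1f e0).
near=> r => z z' xz xz'.
have seg (s : R) : 0 <= s <= 1 -> ball x r0 (z' + s *: (z - z')).
  move=> /andP[s0 s1].
  have rr0 : r <= r0 by near: r; exact: nbhs_right_le.
  apply: (le_ball rr0).
  move: xz xz'; rewrite -!ball_normE /= => xz xz'.
  have -> : x - (z' + s *: (z - z')) = s *: (x - z) + (1 - s) *: (x - z').
    have -> : z - z' = (x - z') - (x - z) by rewrite opprB [RHS]addrC addrA subrK.
    by rewrite opprD addrA scalerBr opprB scalerBl scale1r addrCA.
  rewrite (le_lt_trans (ler_normD _ _))// !normrZ ger0_norm// ger0_norm ?subr_ge0//.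
  (* The strict inequality is taken from the term with factor [s], so [s = 0] is treated apart. *)
  have [->|s_neq0] := eqVneq s 0; first by rewrite mul0r add0r subr0 mul1r.
  have -> : r = s * r + (1 - s) * r by rewrite -mulrDl addrC subrK mul1r.
  have s_gt0 : 0 < s by rewrite lt_def s_neq0.
  by apply: ltr_leD; [rewrite ltr_pM2l|rewrite ler_wpM2l ?subr_ge0// ltW].
have dseg (s : R) : 0 <= s <= 1 -> is_derive s 1 (fun s => f (z' + s *: (z - z')))
    ('d f (z' + s *: (z - z')) (z - z')).
  by move=> /seg/dfe[df _]; exact: is_derive_segment.
have -> : f z - 'd f x z - (f z' - 'd f x z') = f z - f z' - 'd f x (z - z').
  by rewrite (linearB ('d f x)); ring.
have [s /[!in_itv]/= s01||c /[!in_itv]/= c01] := @MVT_segment R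
  (fun s => f (z' + s *: (z - z'))) (fun s => 'd f (z' + s *: (z - z')) (z - z')) 0 1 ler01.
- by apply: dseg; case/andP: s01 => /ltW-> /ltW->.
- apply: derivable_within_continuous => s /[!in_itv]/= s01.
  by apply: ex_derive; exact: dseg.
rewrite scale1r scale0r addr0 [z' + _]addrC subrK subr0 mulr1 => ->.
by have /seg/dfe[_] := c01; apply.
Unshelve. all: by end_near. Qed.
End Calculus.

(** * Finite families: bases, dual vectors, stability of independence *)

Section LinearIndependence.
Context {R : realType} {K : finType}.

Lemma lin_indepS (V : lmodType R) (v : K -> V) (S T : {set K}) :
  T \subset S -> lin_indep v S -> lin_indep v T.
Proof.
move=> TS vS c c0 k kT.
have := vS (fun k => if k \in T then c k else 0) _ k (fintype.subsetP TS _ kT).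
rewrite kT; apply; rewrite -[RHS]c0 [LHS]big_mkcond [RHS]big_mkcond.
apply: eq_bigr => i _; have [iT|iT] := boolP (i \in T).
  by rewrite (fintype.subsetP TS _ iT).
by rewrite scale0r if_same.
Qed.

(** The maximum is attained because the empty family is independent. *)
Lemma family_rank_basis (V : lmodType R) (v : K -> V) (S : {set K}) :
  exists T : {set K}, [/\ T \subset S, lin_indep v T & #|T| = family_rank v S].
Proof.
have := @eq_bigmax_cond _
  [pred T : {set K} | (T \subset S) && `[< lin_indep v T >]] (fun T => #|T|).
case=> [|T /andP[TS /asboolP vT] rT]; last by exists T.
apply/card_gt0P; exists finset.set0.
rewrite inE/= finset.sub0set; apply/asboolP => c _ k; by rewrite inE.
Qed.

(** For [i] outside [T], an independent [i |: T] would exceed the rank. In a nontrivial relation the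
    coefficient of [v i] is nonzero, [T] being independent, so [v i] can be solved for. *)
Lemma lin_indep_span (V : lmodType R) (v : K -> V) (S T : {set K}) i :
  T \subset S -> lin_indep v T -> #|T| = family_rank v S -> i \in S ->
  exists a : K -> R, v i = \sum_(k in T) a k *: v k.
Proof.
move=> TS vT rT iS; have [iT|iT] := boolP (i \in T).
  exists (fun k => (k == i)%:R); rewrite (bigD1 i)//= eqxx scale1r big1 ?addr0//.
  by move=> k /andP[_ /negPf->]; rewrite scale0r.
have iTS : i |: T \subset S by rewrite finset.subUset finset.sub1set iS.
have : ~ lin_indep v (i |: T).
  move=> viT.
  have : (#|i |: T| <= family_rank v S)%N.
    by apply: leq_bigmax_cond; rewrite iTS; apply/asboolP.
  by rewrite cardsU1 iT rT add1n ltnn.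
move=> /existsNP[c /not_implyP[]]; rewrite big_setU1//= => c0 cN0.
have ci0 : c i != 0.
  apply/eqP => ci0; apply: cN0 => k; rewrite !inE => /orP[/eqP->//|kT].
  by apply: vT kT; rewrite -[RHS]c0 ci0 scale0r add0r.
exists (fun k => - (c i)^-1 * c k).
under eq_bigr do rewrite -scalerA.
rewrite -scaler_sumr; apply: (@scalerI _ _ (c i)) => //.
rewrite scalerA mulrN mulfV// scaleN1r.
by apply/eqP; rewrite -addr_eq0 c0.
Qed.

Lemma lin_indep_funP (T : Type) (v : K -> T -> R^o) (S : {set K}) :
  lin_indep v S <-> forall c : K -> R,
    (forall x, \sum_(k in S) c k * v k x = 0) -> forall k, k \in S -> c k = 0.
Proof.
split=> vS c c0; apply: vS.
  by apply/funext => x; rewrite fct_sumE; exact: c0.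
by move=> x; have := congr1 (fun f => f x) c0; rewrite fct_sumE.
Qed.

(** Induction on [#|S|] in the manner of Gram-Schmidt: a dual family for [S :\ a] is completed by a
    vector for [a] and then corrected. *)
Lemma lin_indep_dual (E : lmodType R) (v : K -> {linear E -> R^o}) (S : {set K}) :
  lin_indep (fun k => v k : E -> R^o) S ->
  exists e : K -> E, forall i j, i \in S -> j \in S -> v i (e j) = (i == j)%:R.
Proof.
have [m] := ubnP #|S|; elim: m S => // m IH S; rewrite ltnS => Sm vS.
have [->|[a aS]] := set_0Vmem S; first by exists (fun=> 0) => i j; rewrite inE.
have S'S : S :\ a \subset S by exact: subD1set.
have [|e ve] := IH (S :\ a) _ (lin_indepS S'S vS).
  by rewrite (leq_trans _ Sm)// [ltnRHS](cardsD1 a) aS.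
(* Otherwise [v a] would be the combination of the other functionals with coefficients
   [v a (e j)]. *)
have [x wx0] : exists x,
    v a x - \sum_(j in S :\ a) v a (e j) * v j x != 0.
  apply: contrapT => /forallNP w0; move/lin_indep_funP : vS.
  move=> /(_ (fun k => if k == a then 1 else - v a (e k)) _ a aS).
  rewrite eqxx => v10; suff /v10/eqP : forall x, \sum_(k in S)
    (if k == a then 1 else - v a (e k)) * v k x = 0 by rewrite oner_eq0.
  move=> x.
  rewrite (bigD1 a)//= eqxx mul1r.
  have /negP := w0 x; rewrite negbK => /eqP vax0; rewrite -[RHS]vax0; congr (_ + _).
  rewrite -sumrN. apply: eq_big => [k|k /andP[_ /negPf->]]; last by rewrite mulNr.
  by rewrite !inE andbC.
set w := (X in X != 0) in wx0.
(* Removing the components along the [e j] kills every [v j] with [j] in [S :\ a] and leaves [v a]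
   with value [w], which is scaled to 1. *)
pose y := w^-1 *: (x - \sum_(j in S :\ a) v j x *: e j).
have vy i : i \in S -> v i y = (i == a)%:R.
  move=> iS; rewrite linearZ/= linearB/= linear_sum/=.
  under eq_bigr do rewrite linearZ/=.
  have [->|ia] := eqVneq i a.
    apply/eqP; rewrite -(inj_eq (mulfI wx0)) mulr1n mulr1 mulrA mulfV// mul1r /w.
    by apply/eqP; congr (_ - _); apply: eq_bigr => j _; rewrite mulrC.
  have iSa : i \in S :\ a by rewrite !inE ia.
  rewrite (bigD1 i)//= ve// eqxx [_ *: true%:R]mulr1 big1 ?addr0 ?subrr ?scaler0//.
  by move=> j /andP[jS ji]; rewrite ve// eq_sym (negPf ji) scaler0.
(* The correction makes [v a] vanish on the other vectors; the other functionals do not see it,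
   since they vanish at [y]. *)
exists (fun j => if j == a then y else e j - v a (e j) *: y) => i j iS jS.
case: eqVneq => [->|ja]; first exact: vy.
have jSa : j \in S :\ a by rewrite !inE ja.
rewrite linearB linearZ/= vy//; have [->|ia] := eqVneq i a.
  by rewrite [_ *: true%:R]mulr1 subrr eq_sym (negPf ja).
by rewrite scaler0 subr0 ve// !inE ia.
Qed.

(** The matrix [w i (e j)] is close to the identity: for the coefficients of a relation, the sum [A]
    of absolute values is at most [#|S| / (#|S| + 1)] times itself, hence zero. *)
Lemma lin_indep_stable (E : Type) (v w : K -> E -> R^o) (S : {set K}) (e : K -> E) :
  (forall i j, i \in S -> j \in S -> v i (e j) = (i == j)%:R) ->
  (forall i j, i \in S -> j \in S -> `|w i (e j) - v i (e j)| <= #|S|.+1%:R^-1) ->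
  lin_indep w S.
Proof.
move=> ve we; apply/lin_indep_funP => c c0.
pose A := \sum_(k in S) `|c k|.
have cA m : m \in S -> `|c m| <= #|S|.+1%:R^-1 * A.
  move=> mS; have -> : c m = \sum_(k in S) c k * (v k (e m) - w k (e m)).
    under eq_bigr do rewrite mulrBr.
    rewrite sumrB c0 subr0 (bigD1 m)//= ve// eqxx mulr1 big1 ?addr0// => k.
    by move=> /andP[kS /negPf km]; rewrite ve// km mulr0.
  rewrite (le_trans (ler_norm_sum _ _ _))// mulr_sumr ler_sum// => k kS.
  by rewrite normrM mulrC ler_wpM2r// distrC we.
have : A <= #|S|%:R * (#|S|.+1%:R^-1 * A).
  by rewrite mulr_natl -sumr_const; exact: ler_sum.
rewrite mulrA -subr_le0 -{1}[A]mul1r -mulrBl pmulr_rle0; last first.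
  by rewrite subr_gt0 ltr_pdivrMr// mul1r ltr_nat.
move=> A0 k kS; apply/eqP; rewrite -normr_le0 (le_trans _ A0)//.
by rewrite /A (bigD1 k)//= lerDl sumr_ge0.
Qed.

End LinearIndependence.

(** * Difference quotients along tangent curves *)

Section Curves.
Context {R : realType} {E : normedModType R}.
Implicit Types (f : E -> R) (x d v z : E) (o : R -> E).

Lemma differentiable_near f x (e : R) : differentiable f x -> 0 < e ->
  \forall z \near x, `|f z - f x - 'd f x (z - x)| <= e * `|z - x|.
Proof.
move=> /diff_locally/eqaddoP df e0; apply/nbhs0P.
near=> y; rewrite [x + y]addrC addrK -addrA -opprD.
by near: y; exact: df.
Unshelve. all: by end_near. Qed.

Lemma curve_cvg x d o : `|o t| * t^-1 @[t --> 0^'+] --> (0 : R) ->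
  x + t *: d + o t @[t --> 0^'+] --> x.
Proof.
move=> oo; rewrite -[X in _ --> X]addr0; apply: cvgD.
  rewrite -[X in _ --> X]addr0; apply: cvgD; first exact: cvg_cst.
  rewrite -[X in _ --> X](scale0r d); apply: cvgZr_tmp.
  exact: cvg_at_right_filter.
apply/norm_cvg0P.
have : (`|o t| * t^-1) * t @[t --> 0^'+] --> (0 * 0 : R).
  by apply: cvgM => //; exact: cvg_at_right_filter.
rewrite mulr0; apply: cvg_trans; apply: near_eq_cvg; near=> t.
by rewrite divfK// gt_eqF.
Unshelve. all: by end_near. Qed.

Lemma curve_derivative f x d o : differentiable f x ->
  `|o t| * t^-1 @[t --> 0^'+] --> (0 : R) ->
  (f (x + t *: d + o t) - f x) / t @[t --> 0^'+] --> 'd f x d.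
Proof.
move=> dfx oo; have [M M0 dfM] := diff_norm_bound dfx.
have xo := @curve_cvg x d o oo.
apply/cvgrPdist_le => e e0.
pose e1 := e / 2 / (`|d| + 1).
have d10 : 0 < `|d| + 1 by rewrite ltr_wpDl.
have e10 : 0 < e1 by rewrite !divr_gt0.
have fxo := xo _ (differentiable_near dfx e10).
near=> t.
have t0 : 0 < t by [].
set z := x + t *: d + o t.
have zx : z - x = t *: d + o t by rewrite /z -[x + _ + _]addrA addrAC subrr add0r.
have fz : `|f z - f x - 'd f x (z - x)| <= e1 * `|z - x|.
  by rewrite /z; near: t; exact: fxo.
(* The bound 1 gives [|z - x| <= t * (|d| + 1)], so the first-order remainder costs at most
   [e / 2 * t]; the other bound does the same for ['d f x (o t)]. *)
have ot : `|o t| / t <= Num.min 1 (e / 2 / M).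
  near: t; move/cvgrPdist_le : oo => /(_ (Num.min 1 (e / 2 / M))).
  have m0 : 0 < Num.min 1 (e / 2 / M) by rewrite lt_min ltr01 !divr_gt0.
  move=> /(_ m0); apply: filter_app; near=> t.
  by rewrite sub0r normrN; exact/le_trans/ler_norm.
move: ot; rewrite le_min => /andP[ot1 otM].
rewrite -(ler_pM2r t0) -{2}(gtr0_norm t0) -normrM mulrBl divfK ?gt_eqF//.
have -> : 'd f x d * t - (f z - f x) =
    - (f z - f x - 'd f x (z - x)) - 'd f x (o t).
  have dzE : 'd f x (z - x) = t * 'd f x d + 'd f x (o t).
    by rewrite zx linearD linearZ.
  by rewrite dzE; ring.
rewrite (le_trans (ler_normB _ _))// normrN (le_trans (lerD fz (dfM _)))// zx.
move: ot1 otM; rewrite !ler_pdivrMr// mul1r => ot1 otM.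
have -> : e * t = e1 * (t * `|d| + t) + M * (e / 2 / M * t).
  by rewrite /e1; field; rewrite !gt_eqF.
rewrite lerD// ?ler_pM2l//.
by rewrite (le_trans (ler_normD _ _))// normrZ gtr0_norm// lerD2l.
Unshelve. all: by end_near. Qed.

End Curves.

(** * Maps with strict derivative zero *)

Section Flat.
Context {R : realType} {V W : normedModType R}.

Lemma strictly_flat_ex (f : V -> W) x (e : R) : strictly_flat f x -> 0 < e ->
  exists2 r : R, 0 < r & forall z z',
    ball x r z -> ball x r z' -> `|f z - f z'| <= e * `|z - z'|.
Proof.
by move=> fx e0; near (0 : R)^'+ => r; exists r => //; near: r; exact: fx.
Unshelve. all: by end_near. Qed.

Lemma strictly_flat_sum (K : finType) (S : {set K}) (f : K -> V -> R) (e : K -> W) x :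
  (forall k, k \in S -> strictly_flat (f k) x) ->
  strictly_flat (fun z => \sum_(k in S) f k z *: e k) x.
Proof.
(* Each [f k] gets the tolerance [a / C], so that the weighted sum stays within [a]; the summand 1
   keeps [C] positive. *)
move=> fx a a0; pose C := 1 + \sum_(k in S) `|e k|.
have C0 : 0 < C by rewrite ltr_pwDl// sumr_ge0.
have : \forall r \near 0^'+, forall k, k \in S -> forall z z',
    ball x r z -> ball x r z' -> `|f k z - f k z'| <= a / C * `|z - z'|.
  apply: filter_forall => k; have [kS|kS] := boolP (k \in S); last first.
    by near=> r.
  have := fx k kS _ (divr_gt0 a0 C0); apply: filter_app; near=> r.
  by move=> + _; apply.
apply: filter_app; near=> r => fr z z' xz xz'.
rewrite -sumrB; under eq_bigr do rewrite -scalerBl.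
rewrite (le_trans (ler_norm_sum _ _ _))//.
rewrite (@le_trans _ _ (\sum_(k in S) a / C * `|z - z'| * `|e k|))//.
  by apply: ler_sum => k kS; rewrite normrZ ler_wpM2r// fr.
rewrite -mulr_sumr mulrAC ler_wpM2r// mulrAC ler_pdivrMr// ler_pM2l//.
by rewrite lerDr.
Unshelve. all: by end_near. Qed.

Lemma strictly_flat_cvg (f : V -> W) x : strictly_flat f x -> f z @[z --> x] --> f x.
Proof.
move=> fx; have [r r0 fr] := strictly_flat_ex fx ltr01.
apply/cvgrPdist_le => e e0.
near=> z; rewrite distrC (le_trans (fr _ _ _ (ballxx _ r0)))//.
  by near: z; exact: nbhsx_ballx.
by rewrite mul1r distrC ltW//; near: z; exact: nbhsx_ballx.
Unshelve. all: by end_near. Qed.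

End Flat.

(** * Curves defined by a contraction *)

Section ImplicitCurve.
Context {R : realType} {E : completeNormedModType R}.

(** Banach's fixed point theorem on a closed ball; completeness of [E] enters here. *)
Lemma ball_fixed_point (G : E -> E) (rho q : R) : 0 <= q < 1 -> 0 < rho ->
  (forall p, `|p| <= rho -> `|G p| <= rho) ->
  (forall p p', `|p| <= rho -> `|p'| <= rho -> `|G p - G p'| <= q * `|p - p'|) ->
  exists2 p, `|p| <= rho & p = G p.
Proof.
move=> /andP[q0 q1] rho0 Grho Gq; pose U := [set p : E | `|p| <= rho].
have GU : {homo G : p / U p >-> U p} by [].
have cU : closed U.
  have -> : U = closed_ball_ Num.norm 0 rho.
    by apply/seteqP; split=> p; rewrite /U /closed_ball_ /= sub0r normrN.
  exact: closed_closed_ball_.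
have [||p Up pG] := @banach_fixed_point _ _ U (mkfun GU) _ cU.
- exists (NngNum q0); split => //= -[p p'] /= [Up Up']; exact: Gq.
- by exists 0; rewrite /U /= normr0 ltW.
- by exists p.
Qed.

(** Flatness passes from [G] to [r] in two rounds: a crude Lipschitz bound on [r] keeps the curve
    close to [x], where [G] has a small Lipschitz constant, and this sharpens the bound. *)
Lemma implicit_curve (G : E -> E) (x d : E) : strictly_flat G x -> G x = 0 ->
  exists r : R -> E, [/\ r 0 = 0, strictly_flat r 0 &
    \forall t \near 0, r t = G (x + t *: d + r t)].
Proof.
move=> Gx Gx0.
have half0 : 0 < 1 / 2 :> R by rewrite divr_gt0.
have [rho rho0 Gr] := strictly_flat_ex Gx half0.
have d10 : 0 < `|d| + 1 by rewrite ltr_wpDl.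
(* With [t *: d] and [p] of norm at most [rho / 3], the point stays in the ball of radius [rho], and
   the Lipschitz constant 1/2 of [G] sends [p] back to norm at most [rho / 3]. *)
pose del := rho / 3 / (`|d| + 1).
have del0 : 0 < del by rewrite !divr_gt0.
have tdle t : `|t| < del -> `|t *: d| < rho / 3.
  rewrite /del ltr_pdivlMr// => tdel; rewrite normrZ (le_lt_trans _ tdel)//.
  by rewrite ler_wpM2l// lerDl.
have zin t p : `|t| < del -> `|p| <= rho / 3 -> ball x rho (x + t *: d + p).
  move=> /tdle tdel prho; rewrite -ball_normE /= -addrA opprD addrA subrr sub0r normrN.
  rewrite (le_lt_trans (ler_normD _ _))//; lra.
(* [choice] asks for a value at every [t]; outside the interval it is an arbitrary 0. *)
have /choice[r rP] : forall t, exists p, `|t| < del ->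
    `|p| <= rho / 3 /\ p = G (x + t *: d + p).
  move=> t.
  have [tdel|_] := ltP `|t| del; last by exists 0.
  have [||||p prho pG] := @ball_fixed_point (fun p => G (x + t *: d + p)) (rho / 3) (1 / 2).
  - by apply/andP; split; lra.
  - by rewrite divr_gt0.
  - move=> p prho; rewrite -[G _]subr0 -Gx0.
    rewrite (le_trans (Gr _ _ (zin _ _ tdel prho) (ballxx _ rho0)))//.
    have -> : x + t *: d + p - x = t *: d + p.
      by rewrite -[x + _ + _]addrA addrAC subrr add0r.
    have := ler_normD (t *: d) p; have := tdle _ tdel; lra.
  - move=> p p' prho p'rho.
    rewrite (le_trans (Gr _ _ (zin _ _ tdel prho) (zin _ _ tdel p'rho)))//.
    by rewrite opprD addrACA subrr add0r.
  - by exists p.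
have del00 : `|0 : R| < del by rewrite normr0.
(* Since [e <= 1 / 2], the term [e * |r t - r t'|] on the right is absorbed on the left, at the cost
   of a factor 2. *)
have rlip e rho' : 0 < e <= 1 / 2 -> (forall z z', ball x rho' z -> ball x rho' z' ->
    `|G z - G z'| <= e * `|z - z'|) ->
    forall t t', `|t| < del -> `|t'| < del ->
      ball x rho' (x + t *: d + r t) -> ball x rho' (x + t' *: d + r t') ->
      `|r t - r t'| <= 2 * e * `|d| * `|t - t'|.
  move=> /andP[e0 e1] Ge t t' tdel t'del tz t'z.
  have := Ge _ _ tz t'z; rewrite -(rP _ tdel).2 -(rP _ t'del).2.
  have -> : x + t *: d + r t - (x + t' *: d + r t') = (t - t') *: d + (r t - r t').
    rewrite scalerBl opprD addrACA; congr (_ + _).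
    by rewrite opprD addrACA subrr add0r.
  move=> /le_trans rle.
  have {}rle := rle _ (ler_wpM2l (ltW e0) (ler_normD _ _)).
  move: rle; rewrite normrZ mulrDr => rle.
  have : e * `|r t - r t'| <= 1 / 2 * `|r t - r t'| by rewrite ler_wpM2r.
  lra.
have rL t t' : `|t| < del -> `|t'| < del -> `|r t - r t'| <= `|d| * `|t - t'|.
  move=> tdel t'del.
  have zr u : `|u| < del -> ball x rho (x + u *: d + r u).
    by move=> udel; apply: zin => //; apply: (rP _ _).1.
  have := rlip (1 / 2) rho _ Gr t t' tdel t'del (zr _ tdel) (zr _ t'del).
  have -> : 2 * (1 / 2) * `|d| = `|d| :> R by lra.
  by apply; rewrite lexx half0.
(* At [t = 0] the contraction bounds [|r 0|] by half of itself. *)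
have r00 : r 0 = 0.
  have [r0rho r0G] := rP _ del00.
  have := Gr _ _ (zin _ _ del00 r0rho) (ballxx _ rho0).
  rewrite Gx0 -r0G subr0 scale0r addr0 addrAC subrr add0r => r0le.
  apply/eqP; rewrite -normr_le0; lra.
exists r; split => //.
  (* The first bound allows the absorption in [rlip]; the second makes [2 * e1 * |d|] at most
     [e]. *)
  move=> e e0; pose e1 := Num.min (1 / 2) (e / 2 / (`|d| + 1)).
  have e10 : 0 < e1 by rewrite lt_min !divr_gt0.
  have [rho1 rho10 Gr1] := strictly_flat_ex Gx e10.
  near=> s => t t'; rewrite -!ball_normE /= !sub0r !normrN => ts t's.
  have sdel : s <= del by near: s; exact: nbhs_right_le.
  (* Both [u *: d] and [r u] have norm at most [|d| * |u|], whence the division by 2. *)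
  have srho1 : s <= rho1 / 2 / (`|d| + 1).
    by near: s; apply: nbhs_right_le; rewrite !divr_gt0.
  have zin1 u : `|u| < s -> ball x rho1 (x + u *: d + r u).
    move=> us; rewrite -ball_normE /= -addrA opprD addrA subrr sub0r normrN.
    have := rL u 0 (lt_le_trans us sdel) del00; rewrite r00 !subr0 => ru.
    rewrite (le_lt_trans (ler_normD _ _))// normrZ.
    have : `|u| * (`|d| + 1) < rho1 / 2.
      by rewrite -ltr_pdivlMr// (lt_le_trans us).
    have := normr_ge0 u; lra.
  rewrite (le_trans (rlip e1 rho1 _ Gr1 t t' _ _ _ _))//.
  - by rewrite e10 ge_min lexx.
  - exact: lt_le_trans sdel.
  - exact: lt_le_trans sdel.
  - exact: zin1.
  - exact: zin1.
  - rewrite ler_wpM2r//.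
    have : e1 <= e / 2 / (`|d| + 1) by rewrite ge_min lexx orbT.
    rewrite ler_pdivlMr// => e1le; lra.
near=> t; apply: (rP _ _).2.
by near: t; apply/nbhs_normP; exists del => //= t; rewrite /= sub0r normrN.
Unshelve. all: by end_near. Qed.

End ImplicitCurve.

Section DiffSum.
Context {R : realType} {V W : normedModType R}.

Lemma is_diff_sum (K : finType) (S : {set K}) (f df : K -> V -> W) x :
  (forall k, k \in S -> is_diff x (f k) (df k)) ->
  is_diff x (\sum_(k in S) f k) (\sum_(k in S) df k).
Proof.
move=> fx; apply: (big_ind2 (fun F D => is_diff x F D)) => //.
- exact: is_diff_cst.
- by move=> F D G D' ? ?; exact: is_diffD.
Qed.

End DiffSum.

(** * Functions constant along a Lipschitz curve *)

Section ConstantAlongCurve.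
Context {R : realType} {E : normedModType R}.

(** A chain rule without a derivative of [z]: as the differential of [g] vanishes at [z t], the
    increment of [g] is $o(|z(s)-z(t)|)$, hence $o(|s-t|)$. *)
Lemma is_derive_comp_diff0 (g : E -> R) (z : R -> E) (t L : R) :
  differentiable g (z t) -> (forall v, 'd g (z t) v = 0) ->
  (\forall s \near t, `|z s - z t| <= L * `|s - t|) ->
  is_derive t 1 (g \o z) 0.
Proof.
move=> dg dg0 zL; pose M := `|L| + 1.
have M0 : 0 < M by rewrite ltr_wpDl.
have {}zL : \forall s \near t, `|z s - z t| <= M * `|s - t|.
  apply: filterS zL => s /le_trans; apply.
  by rewrite ler_wpM2r// (le_trans (ler_norm _))// lerDl.
have zt : z s @[s --> t] --> z t.
  apply/cvgrPdist_le => e e0.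
  have := nbhsx_ballx t _ (divr_gt0 e0 M0); apply: filterS2 zL => s sL.
  rewrite -ball_normE /= => st; rewrite distrC (le_trans sL)// mulrC.
  by rewrite -ler_pdivlMr// distrC ltW.
have cvg0 : h^-1 *: ((g \o z) (h *: (1 : R) + t) - (g \o z) t) @[h --> 0^'] --> (0 : R).
  apply/cvgrPdist_le => e e0.
  have gz := zt _ (differentiable_near dg (divr_gt0 e0 M0)).
  have : \forall s \near t, `|g (z s) - g (z t)| <= e * `|s - t|.
    apply: filterS2 zL gz => s sL /=; rewrite dg0 subr0 => /le_trans; apply.
    by rewrite -mulrA ler_pM2l// mulrC ler_pdivrMr// mulrC.
  move=> /nbhs0P/nbhs_dnbhs; apply: filterS2 (nbhs_dnbhs_neq _) => h h0.
  rewrite [t + h]addrC addrK sub0r normrN normrZ normfV => gh.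
  by rewrite mulrC ler_pdivrMr ?normr_gt0//= [_ *: _]mulr1.
by apply: DeriveDef; [apply/cvg_ex; exists 0|exact: cvg_lim].
Qed.

(** The function [g] may change with [t]. Replacing [f] by it leaves the values on the curve
    unchanged, so [f \o z] has derivative zero throughout and the mean value theorem applies. *)
Lemma constant_along_curve (f : E -> R) (z : R -> E) (del L : R) : 0 < del ->
  (forall s t, `|s| < del -> `|t| < del -> `|z s - z t| <= L * `|s - t|) ->
  (forall t, `|t| < del -> exists g : E -> R, [/\ differentiable g (z t),
     forall v, 'd g (z t) v = 0 & forall s, `|s| < del -> g (z s) = f (z s)]) ->
  forall t, `|t| < del -> f (z t) = f (z 0).
Proof.
move=> del0 zL fg.
have fz' (t : R) : `|t| < del -> is_derive t 1 (f \o z) 0.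
  move=> tdel; have [g [dg dg0 gf]] := fg t tdel.
  have near_del : \forall s \near t, `|s| < del.
    have := nbhsx_ballx t (del - `|t|); rewrite subr_gt0 => /(_ tdel).
    apply: filterS => s; rewrite -ball_normE /= ltrBrDr => /(le_lt_trans _); apply.
    by rewrite -{1}[s](subrK t) distrC ler_normD.
  have := @is_derive_comp_diff0 g z t L dg dg0; move=> /(_ _)[|dgz Dgz].
    by apply: filterS near_del => s sdel; exact: zL.
  have gfz : {near t, g \o z =1 f \o z} by apply: filterS near_del => s /gf.
  apply: DeriveDef; first exact: near_eq_derivable gfz dgz.
  by rewrite -(near_eq_derive _ gfz).
have cst (a b : R) : - del < a -> a <= b -> b < del -> f (z b) = f (z a).
  move=> dela ab bdel.
  have dz (s : R) : a <= s <= b -> is_derive s 1 (f \o z) 0.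
    move=> /andP[ras sb]; apply: fz'; rewrite ltr_norml.
    by rewrite (lt_le_trans dela)// (le_lt_trans sb).
  have [s /[!in_itv]/= sab||c _ ] := @MVT_segment _ (f \o z) (cst 0) a b ab.
  - by apply: dz; case/andP: sab => /ltW-> /ltW->.
  - apply: derivable_within_continuous => s /[!in_itv]/= sab.
    by apply: ex_derive; exact: dz.
  by rewrite mul0r => /subr0_eq.
move=> t; rewrite ltr_norml => /andP[dt td].
by have [t0|/ltW t0] := leP 0 t; [|symmetry]; apply: cst; rewrite // oppr_lt0.
Qed.

End ConstantAlongCurve.

(** * Curves in a zero set of constant rank *)

Section ConstantRank.
Context {R : realType} {E : completeNormedModType R} {K : finType}.

(** Constant rank replaces the surjectivity of the derivative in Lyusternik's theorem: only the
    equations of a basis [S] of gradients are solved, and the others follow. *)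
Lemma constant_rank_curve (h : K -> E -> R) (x d : E) (J : {set K}) :
  (forall i, i \in J -> C1_near (h i) x) ->
  (forall i, i \in J -> h i x = 0) -> (forall i, i \in J -> 'd (h i) x d = 0) ->
  (\forall y \near x, family_rank (fun i => 'd (h i) y : E -> R^o) J =
                      family_rank (fun i => 'd (h i) x : E -> R^o) J) ->
  exists r : R -> E, [/\ r 0 = 0, strictly_flat r 0 &
    \forall t \near 0, forall i, i \in J -> h i (x + t *: d + r t) = 0].
Proof.
move=> C1h hx0 dhd rkh.
have [S [SJ indS cS]] := family_rank_basis (fun i => 'd (h i) x : E -> R^o) J.
have inJ i : i \in S -> i \in J by exact: (fintype.subsetP SJ).
have [e dhe] := @lin_indep_dual _ _ _ (fun i => 'd (h i) x : {linear E -> R^o}) S indS.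
(* The constant term turns the coefficient into [h j z - 'd (h j) x (z - x)], which vanishes at
   [x]. *)
pose G z := \sum_(j in S) (h j z - 'd (h j) x z + 'd (h j) x x) *: - e j.
have flatG : strictly_flat G x.
  apply: strictly_flat_sum => j /inJ/C1h/C1_near_strictly_flat hf a /hf.
  apply: filterS => r hr z z' xz xz'.
  by rewrite opprD addrACA subrr addr0; exact: hr.
have Gx : G x = 0.
  by rewrite /G big1// => j /inJ/hx0->; rewrite sub0r addNr scale0r.
have [r [r0 flatr rG]] := @implicit_curve _ _ G x d flatG Gx.
exists r; split => //.
(* Applying ['d (h i) x] to the fixed point equation isolates the coefficient of [e i]; as
   ['d (h i) x d = 0], the linear terms cancel and [h i z = 0] remains. *)
have hS : \forall t \near 0, forall i, i \in S -> h i (x + t *: d + r t) = 0.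
  apply: filterS rG => t rG i iS; set z := x + t *: d + r t in rG *.
  have := congr1 ('d (h i) x) rG; rewrite linear_sum (bigD1 i)//= linearZ linearN/=.
  rewrite dhe// eqxx big1; last first.
    move=> j /andP[jS ji]; rewrite linearZ linearN/= dhe// eq_sym (negPf ji).
    by rewrite oppr0 [_ *: _]mulr0.
  have -> : 'd (h i) x z = 'd (h i) x x + 'd (h i) x (r t).
    by rewrite /z 2!linearD linearZ/= dhd ?inJ// [_ *: _]mulr0 addr0.
  rewrite addr0 [_ *: _]mulrN mulr1; lra.
have indS_near : \forall y \near x, lin_indep (fun i => 'd (h i) y : E -> R^o) S.
  (* [C] dominates every [|e j|], so closeness of the gradients up to the tolerance divided by [C]
     gives the closeness at [e j] that [lin_indep_stable] requires. *)
  pose C := 1 + \sum_(j in S) `|e j|.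
  have C0 : 0 < C by rewrite ltr_pwDl// sumr_ge0.
  have a0 : 0 < #|S|.+1%:R^-1 / C by rewrite divr_gt0.
  have : \forall y \near x, forall i, i \in S -> forall v,
      `|'d (h i) y v - 'd (h i) x v| <= #|S|.+1%:R^-1 / C * `|v|.
    apply: filter_forall => i; have [iS|_] := boolP (i \in S); last by near=> y.
    apply: filterS (C1_near_diff_le (C1h _ (inJ _ iS)) a0) => y [_ dy] _; exact: dy.
  apply: filterS => y dy;
  apply: (@lin_indep_stable _ _ _ (fun i => 'd (h i) x : E -> R^o) _ _ e) => // i j iS jS.
  apply: (le_trans (dy i iS (e j))); rewrite -mulrA ler_piMr// mulrC ler_pdivrMr// mul1r.
  by rewrite /C (bigD1 j)//= addrCA lerDl addr_ge0// sumr_ge0.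
have dh_near : \forall y \near x, forall i, i \in J -> differentiable (h i) y.
  apply: filter_forall => i; have [iJ|_] := boolP (i \in J); last by near=> y.
  by apply: filterS (C1h _ iJ) => y [].
have [del del0 [Pdel zlip]] : exists2 del : R, 0 < del &
    (forall t, `|t| < del -> [/\ forall i, i \in S -> h i (x + t *: d + r t) = 0,
      forall i, i \in J -> differentiable (h i) (x + t *: d + r t) &
      forall i, i \in J -> exists a : K -> R, 'd (h i) (x + t *: d + r t) =
        \sum_(k in S) a k *: ('d (h k) (x + t *: d + r t) : E -> R^o) :> (E -> R^o)]) /\
    forall s t, `|s| < del -> `|t| < del -> `|r s - r t| <= 1 * `|s - t|.
  have zt0 : x + t *: d + r t @[t --> 0] --> x.
    rewrite -[X in _ --> X]addr0 -[X in _ --> _ + X]r0.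
    apply: cvgD; last exact: strictly_flat_cvg.
    rewrite -[X in _ --> X]addr0; apply: cvgD; first exact: cvg_cst.
    by rewrite -[X in _ --> X](scale0r d); apply: cvgZr_tmp; exact: cvg_id.
  have [rho rho0 rr] := strictly_flat_ex flatr ltr01.
  (* Near [x] the family [S] is still independent and its size is still the rank, so it spans the
     gradients at [y], with coefficients depending on [y]. *)
  have near_x : \forall y \near x, (forall i, i \in J -> differentiable (h i) y) /\
      forall i, i \in J -> exists a : K -> R, 'd (h i) y =
        \sum_(k in S) a k *: ('d (h k) y : E -> R^o) :> (E -> R^o).
    near=> y; split; first by near: y.
    move=> i; apply: (lin_indep_span (v := fun i => 'd (h i) y : E -> R^o)) => //.
      by near: y.
    by rewrite cS; apply/esym; near: y.
  have [del /= del0 near0] := (nbhs_ballP _ _).1 (filterI hS (zt0 _ near_x)).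
  exists (Num.min del rho); first by rewrite lt_min del0.
  split=> [t|s t]; rewrite !lt_min => /andP[tdel trho].
    by have [|hSt [? ?]] := near0 t; first by rewrite -ball_normE /= sub0r normrN.
  by move=> /andP[_ srho]; apply: rr; rewrite -ball_normE /= sub0r normrN.
exists del => // t /=; rewrite sub0r normrN => tdel i iJ.
(* In the Lipschitz constant, [|d|] comes from the line and 1 from [r]. *)
rewrite (@constant_along_curve _ _ (h i) (fun t => x + t *: d + r t) del (`|d| + 1))//.
- by rewrite scale0r r0 !addr0 hx0.
- move=> s u sdel udel; rewrite mulrDl [`|d| * _]mulrC -normrZ.
  have -> : x + s *: d + r s - (x + u *: d + r u) = (s - u) *: d + (r s - r u).
    rewrite scalerBl opprD addrACA; congr (_ + _).
    by rewrite opprD addrACA subrr add0r.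
  by rewrite (le_trans (ler_normD _ _))// lerD2l zlip.
- move=> u udel; have [hSu dhu /(_ i iJ)[a dhi]] := Pdel u udel.
  set z := x + u *: d + r u in hSu dhu dhi *.
  have [dsum sumE] : is_diff z (\sum_(k in S) a k *: h k)
      (\sum_(k in S) a k *: ('d (h k) z : E -> R)).
    by apply: is_diff_sum => k /inJ/dhu dhk; apply: is_diffZ; exact: differentiableP.
  (* The coefficients are frozen at the point [z]: the differential cancels there, while the
     subtracted sum vanishes along the whole curve. *)
  exists (h i - \sum_(k in S) a k *: h k); split.
  + by apply: differentiableB => //; exact: dhu.
  + move=> v; rewrite diffB//; last exact: dhu.
    by rewrite /= sumE dhi; apply/eqP; rewrite subr_eq0.
  + move=> s /Pdel[hSs _ _]; rewrite !fctE fct_sumE big1 ?subr0// => k kS.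
    by rewrite fctE /= hSs// scaler0.
Unshelve. all: by end_near. Qed.

End ConstantRank.

(** Expanding rows in the basis [delta_mx 0 j] reduces this to the rule for sums; it serves to check
    membership in $\ker Dh(x_0)$ componentwise. *)
Lemma differential_row (R : realType) (E : normedModType R) (k : nat)
    (f : 'I_k -> E -> R) (x : E) : (forall j, differentiable (f j) x) ->
  'd (fun y : E => \row_(j < k) f j y) x = (fun v => \row_(j < k) 'd (f j) x v)
    :> (E -> 'rV[R]_k).
Proof.
move=> df.
have rowE (g : 'I_k -> E -> R) : (fun y => \row_(j < k) g j y) =
    \sum_(j in [set: 'I_k]%SET) (fun y => g j y *: delta_mx 0 j) :> (E -> 'rV[R]_k).
  apply/funext => y; rewrite fct_sumE [LHS]row_sum_delta.
  by apply: eq_big => [j|j _]; rewrite ?inE// mxE.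
have [_ +] : is_diff x (fun y : E => \row_(j < k) f j y)
    (fun v => \row_(j < k) 'd (f j) x v).
  rewrite !rowE; apply: is_diff_sum => j _.
  apply: DiffDef; first exact: differentiableZl.
  by rewrite diffZl.
by [].
Qed.

(** * Tangent and linearized cones *)

Section TangentCone.
Context {R : realType} {E : normedModType R} {n : nat}.
Variables (I0 I : {set 'I_n}) (h : 'I_n -> E -> R) (x : E).
Hypotheses (Fx : feasible I0 I h x) (dh : forall i, differentiable (h i) x).

(** Along a feasible curve the difference quotients of active inequalities are nonpositive and those
    of equalities are zero; both properties pass to the limit ['d (h i) x d]. *)
Lemma tangent_cone_sub_linearized :
  tangent_cone (feasible I0 I h) x `<=` linearized_cone I0 I h x.
Proof.
move=> d [eps [ o [eps0 oo Fo]]].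
have F_near : \forall t \near 0^'+, feasible I0 I h (x + t *: d + o t).
  near=> t; apply: Fo; apply/andP; split; first exact: ltW.
  by near: t; exact: nbhs_right_le.
have quot i := curve_derivative (dh i) oo (d := d).
split=> i.
  rewrite inE => /andP[iI /eqP hix].
  apply: cvgr_to_le (quot i) _.
  apply: filterS2 F_near (nbhs_right_gt 0) => t [_ /(_ i iI) ht] t0.
  by rewrite hix subr0 pmulr_lle0// invr_gt0.
move=> iI0.
apply: (cvg_unique _ (quot i)) => //.
have : (fun=> 0 : R) @ (0 : R)^'+ --> (0 : R) by exact: cvg_cst.
apply: cvg_trans; apply: near_eq_cvg; apply: filterS F_near => t [ht _].
by rewrite ht// Fx.1// subrr mul0r.
Unshelve. all: by end_near. Qed.

(** Either [h i x < 0] and continuity suffices, or [h i] is active with ['d (h i) x d < 0], and the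
    difference quotient is eventually negative. *)
Lemma curve_slack (d : E) (o : R -> E) i :
  linearized_cone I0 I h x d -> `|o t| * t^-1 @[t --> 0^'+] --> (0 : R) ->
  i \in I :\: Jdir I0 I h x d ->
  \forall t \near 0^'+, h i (x + t *: d + o t) <= 0.
Proof.
move=> [dle _] oo; rewrite !inE => /andP[iJ iI].
move: iJ; rewrite iI negb_or /= => /andP[_].
have [hix|hix] := eqVneq (h i x) 0; last first.
  move=> _; have hix0 : h i x < 0 by rewrite lt_def eq_sym hix Fx.2.
  have := cvg_comp _ _ (@curve_cvg _ _ x d o oo) (differentiable_continuous (dh i)).
  by move=> /cvgr_lt/(_ _ hix0); apply: filterS => t; exact: ltW.
move=> /= dhix.
have dhi0 : 'd (h i) x d < 0.
  by rewrite lt_def eq_sym dhix dle// inE iI hix eqxx.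
have /cvgr_lt/(_ _ dhi0) := curve_derivative (dh i) oo (d := d).
apply: filterS2 (nbhs_right_gt 0) => t t0; rewrite hix subr0 => /ltW.
by rewrite pmulr_lle0// invr_gt0.
Qed.

End TangentCone.

Lemma strictly_flat_littleo (R : realType) (E : normedModType R) (r : R -> E) :
  strictly_flat r 0 -> r 0 = 0 -> `|r t| * t^-1 @[t --> 0^'+] --> (0 : R).
Proof.
move=> flatr r0; apply/cvgrPdist_le => e e0.
have [rho rho0 rr] := strictly_flat_ex flatr e0.
near=> t; rewrite sub0r normrN normrM normr_id normfV ler_pdivrMr; last first.
  by rewrite normr_gt0 gt_eqF.
rewrite -[t in leRHS]subr0 -[r t]subr0 -r0; apply: rr; last exact: ballxx.
by rewrite -ball_normE /= sub0r normrN gtr0_norm//; near: t; exact: nbhs_right_lt.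
Unshelve. all: by end_near. Qed.

Theorem theorem5p4 (R : realType) (E : completeNormedModType R) (n : nat)
    (I0 I : {set 'I_n}) (hI : I0 :|: I = finset.setT)
    (h : 'I_n -> E -> R) (x0 : E)
    (hx0 : feasible I0 I h x0)
    (hC1 : forall i, C1_near (h i) x0)
    (hRCRCQ : RCRCQ I0 I h x0) :
  linearized_cone I0 I h x0 = tangent_cone (feasible I0 I h) x0 /\
  forall d : E, tangent_cone (feasible I0 I h) x0 d ->
    let J := Jdir I0 I h x0 d in
    exists r : R -> E,
      [/\ `|r t| / t @[t --> 0^'+] --> (0 : R),
          \forall t \near 0^'+,
            (forall i, i \in J -> h i (x0 + t *: d + r t) = 0) /\
            (forall l, l \in I :\: J -> h l (x0 + t *: d + r t) <= 0) &
          J != finset.set0 ->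
            let k := Dh_rank h J x0 in
            (\forall t \near 0^'+, Dh_rank h J (x0 + t *: d + r t) = k) /\
            (forall i_ : 'I_k -> 'I_n,
               (forall j, i_ j \in J) ->
               lin_indep (fun j => 'd (h (i_ j)) x0 : E -> R^o) finset.setT ->
               'd (fun x : E => \row_(j < k) h (i_ j) x) x0 d = 0)].
Proof.
have dh i := C1_near_differentiable (hC1 i).
have [U [Ux0 rankU]] := hRCRCQ.
have JdirS d : I0 \subset Jdir I0 I h x0 d /\
    Jdir I0 I h x0 d \subset I0 :|: active I h x0.
  split; first exact: finset.subsetUl.
  by apply: finset.setUS; apply/fintype.subsetP => i; rewrite inE => /andP[].
(* This one curve yields both the inclusion of the linearized cone in the tangent cone and the
   function [r] of the second claim. *)
have curve d : linearized_cone I0 I h x0 d -> exists r : R -> E,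
    [/\ r 0 = 0, `|r t| * t^-1 @[t --> 0^'+] --> (0 : R) &
      \forall t \near 0^'+,
        (forall i, i \in Jdir I0 I h x0 d -> h i (x0 + t *: d + r t) = 0) /\
        (forall l, l \in I :\: Jdir I0 I h x0 d -> h l (x0 + t *: d + r t) <= 0)].
  move=> Gd; set J := Jdir I0 I h x0 d.
  have [||||r [r0 flatr hr]] := @constant_rank_curve _ _ _ h x0 d J.
  - by [].
  - move=> i; rewrite !inE => /orP[|/andP[/andP[_ /eqP]]] //; exact: hx0.1.
  - by move=> i; rewrite !inE => /orP[/Gd.2//|/andP[_ /eqP]].
  - by apply: filterS Ux0 => y /(rankU J (JdirS d).1 (JdirS d).2).
  have ro := strictly_flat_littleo flatr r0.
  exists r; split => //; near=> t; split; first by near: t; exact: cvg_within hr.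
  near: t; apply: filter_forall => l.
  have [lIJ|_] := boolP (l \in I :\: J); last by near=> t.
  have := curve_slack hx0 dh Gd ro lIJ.
  by apply: filterS => t + _.
have TG := tangent_cone_sub_linearized hx0 dh.
split.
  apply/seteqP; split=> // d Gd.
  have [r [r0 ro hr]] := curve d Gd.
  have F_near : \forall t \near 0^'+, feasible I0 I h (x0 + t *: d + r t).
    apply: filterS hr => t [hJ hIJ]; split=> [i iI0|i iI].
      by apply: hJ; apply/setUP; left.
    have [iJ|iJ] := boolP (i \in Jdir I0 I h x0 d); first by rewrite hJ.
    by apply: hIJ; rewrite inE iJ.
  (* The tangent cone asks for a closed interval containing 0: halving the radius supplies the right
     end, and [r 0 = 0] settles [t = 0]. *)
  have [eps eps0 Feps] : exists2 eps : R, 0 < eps &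
      forall t, 0 < t <= eps -> feasible I0 I h (x0 + t *: d + r t).
    have [e /= e0 Fe] := F_near.
    exists (e / 2); first by rewrite divr_gt0.
    move=> t /andP[t0 te]; apply: Fe => //; rewrite /= sub0r normrN gtr0_norm//.
    lra.
  exists eps, r; split => // t /andP[]; rewrite le_eqVlt => /predU1P[<- _|t0 te].
    by rewrite scale0r r0 !addr0.
  by apply: Feps; rewrite t0.
move=> d Td J; have Gd := TG _ Td.
have [r [r0 ro hr]] := curve d Gd.
exists r; split => // _ k; split.
  (* The curve tends to [x0], so it eventually lies in the neighbourhood [U] of RCRCQ. *)
  have rankJ x : U x -> Dh_rank h J x = k.
    by move=> /(rankU J (JdirS d).1 (JdirS d).2).
  exact: (@curve_cvg _ _ x0 d r ro) (filterS rankJ Ux0).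
move=> i_ iJ _; rewrite differential_row//; apply/rowP => j; rewrite !mxE.
by have := iJ j; rewrite !inE => /orP[/Gd.2//|/andP[_ /eqP]].
Unshelve. all: by end_near. Qed.
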